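(* Let $n,k$ be positive integers with $n\ge 2k+3$. Then for each sign $\epsilon\in\{+,-\}$, $$1^kR^{B,\epsilon}_{n,1}+3^kR^{B,\epsilon}_{n,3}+5^kR^{B,\epsilon}_{n,5}+\cdots=2^kR^{B,\epsilon}_{n,2}+4^kR^{B,\epsilon}_{n,4}+6^kR^{B,\epsilon}_{n,6}+\cdots.$$
   Context: $\mathfrak{B}_n$ is the group of signed permutations in window notation $\pi=\pi_1\cdots\pi_n$, with $\mathrm{inv}_B(\pi)=|\{i<j:\pi_i>\pi_j\}|+|\{i<j:-\pi_i>\pi_j\}|+|\{i:\pi_i<0\}|$. Set $\pi_0=0$; $\mathrm{pk}_B(\pi)$ (resp. $\mathrm{val}_B(\pi)$) is the number of $i\in\{1,\dots,n-1\}$ with $\pi_{i-1}<\pi_i>\pi_{i+1}$ (resp. $\pi_{i-1}>\pi_i<\pi_{i+1}$), and $\mathrm{altruns}_B(\pi)=\mathrm{pk}_B(\pi)+\mathrm{val}_B(\pi)+1$. $\mathfrak{B}_n^+$ is the set of $\pi$ with $\mathrm{inv}_B(\pi)$ even, $\mathfrak{B}_n^-$ its complement. $R^{B,\pm}_{n,j}$ is the number of $\pi\in\mathfrak{B}_n^{\pm}$ with $\mathrm{altruns}_B(\pi)=j$. *)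

(* Defs.v *)
From mathcomp Require Import all_boot all_order all_fingroup all_algebra.

Set Implicit Arguments.
Unset Strict Implicit.
Unset Printing Implicit Defensive.

Import Order.TTheory GRing.Theory Num.Theory.

(* A signed permutation of size n is given by its window pi_1 ... pi_n, encoded
   as the permutation |pi| together with the signs (true means negative):
   pi_(i+1) = (-1) ^ s i * (sigma i + 1) for i : 'I_n. The group law of B_n is
   not needed for the statistics below. *)
Definition signed_perm (n : nat) : finType :=
  ({perm 'I_n} * {ffun 'I_n -> bool})%type.

Definition window (n : nat) (p : signed_perm n) (i : 'I_n) : int :=
  ((-1) ^+ p.2 i * (p.1 i).+1%:Z)%R.

(* pi_m for 0 <= m <= n, with pi_0 = 0; the value 0 for m > n is never used. *)
Definition entry (n : nat) (p : signed_perm n) (m : nat) : int :=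
  if m is m'.+1 then
    if insub m' is Some i then window p i else 0%R
  else 0%R.

Definition inv_B (n : nat) (p : signed_perm n) : nat :=
  #|[set ij : 'I_n * 'I_n |
      (ij.1 < ij.2) && (window p ij.1 > window p ij.2)%R]|
  + #|[set ij : 'I_n * 'I_n |
      (ij.1 < ij.2) && (- window p ij.1 > window p ij.2)%R]|
  + #|[set i : 'I_n | (window p i < 0)%R]|.

(* In pk_B and val_B the index i : 'I_n with 0 < i ranges over 1, ..., n-1 and
   is a position in the sense of entry, not of window. *)
Definition pk_B (n : nat) (p : signed_perm n) : nat :=
  #|[set i : 'I_n |
      [&& 0 < i, (entry p i.-1 < entry p i)%R & (entry p i > entry p i.+1)%R]]|.

Definition val_B (n : nat) (p : signed_perm n) : nat :=
  #|[set i : 'I_n |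
      [&& 0 < i, (entry p i.-1 > entry p i)%R & (entry p i < entry p i.+1)%R]]|.

Definition altruns_B (n : nat) (p : signed_perm n) : nat :=
  pk_B p + val_B p + 1.

Definition B_plus (n : nat) : {set signed_perm n} :=
  [set p | ~~ odd (inv_B p)].

Definition B_minus (n : nat) : {set signed_perm n} := ~: B_plus n.

(* The sign is a boolean: true is +, false is -. *)
Definition B_sign (eps : bool) (n : nat) : {set signed_perm n} :=
  if eps then B_plus n else B_minus n.

Definition R_B (eps : bool) (n j : nat) : nat :=
  #|[set p in B_sign eps n | altruns_B p == j]|.

Lemma altruns_B_le (n : nat) (p : signed_perm n) : 0 < n -> altruns_B p <= n.
Proof.
case: n p => // n p _; rewrite /altruns_B addn1 ltnS /pk_B /val_B.
rewrite -cardsUI [X in _ + X](_ : _ = 0) ?addn0; last first.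
  apply: eq_card0 => i; rewrite !inE; apply/negP.
  by case/andP=> /and3P[_ /lt_trans h _] /and3P[_ /h]; rewrite ltxx.
rewrite -[X in _ <= X]/(n.+1.-1) -[X in _ <= X.-1](card_ord n.+1) -(cardC1 ord0).
apply: subset_leq_card; apply/subsetP => i; rewrite !inE -val_eqE /= -lt0n.
by case/orP => /and3P[].
Qed.

(* The nonzero R_B eps n j have 1 <= j <= n, so sums over all positive j can be
   cut at j = n. *)
Lemma R_B_eq0 (eps : bool) (n j : nat) : 0 < n -> n < j -> R_B eps n j = 0.
Proof.
move=> n_gt0 lt_nj; apply: eq_card0 => p; rewrite !inE.
by apply/negP => /andP[_ /eqP jE]; move: lt_nj; rewrite -jE ltnNge altruns_B_le.
Qed.

(* Main.v *)
Require Import Defs.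
From mathcomp Require Import all_boot all_order all_fingroup all_algebra.
From mathcomp Require Import zify ring.

Set Implicit Arguments.
Unset Strict Implicit.
Unset Printing Implicit Defensive.

Import Order.TTheory GRing.Theory Num.Theory.

(** Negating the suffix pi_i ... pi_n (2 <= i <= n-1) reverses every ascent and
    descent after position i, keeps those before it, and reverses the step from
    pi_(i-1) to pi_i exactly when |pi_(i-1)| < |pi_i|.  Hence it creates or
    destroys exactly one turn, at position i-1 or i according to a condition on
    |pi| alone.  The parity of inv_B is that of the number of inversions of |pi|
    plus the number of negative entries, so it is preserved by suffixes of even
    length.  The suffixes of lengths 2, 4, ..., 2k+2 therefore toggle k+1
    distinct turns independently, and each toggle lowers by one the degree of
    the polynomial in altruns_B whose alternating sum is taken. *)

(** By induction on [K]: the last map pairs each x whose last flag is false with a partner at which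
    [h] is larger by one. The sum collapses to one of (-1)^h (h^k - (h+1)^k) over this half of [S];
    the second factor is a polynomial in h of degree below k, and the earlier maps still act on the
    half. *)
Lemma sum_sign_exp_eq0 (T : finType) (h : T -> nat) (f : nat -> T -> T)
    (b : nat -> T -> bool) (K : nat) (S : {set T}) :
  (forall m, m < K -> involutive (f m)) ->
  (forall m x, m < K -> (f m x \in S) = (x \in S)) ->
  (forall m l x, m < K -> l < K -> b l (f m x) = b l x (+) (l == m)) ->
  (forall m x, m < K -> h (f m x) + b m x = h x + ~~ b m x) ->
  forall k, k < K -> (\sum_(x in S) (-1) ^+ h x * (h x)%:R ^+ k = 0 :> int)%R.
Proof.
elim: K S => [//|K IH] S fK fS bf hf k; rewrite ltnS => le_kK.
pose S' := [set x in S | ~~ b K x].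
have IH' i : i < K -> (\sum_(x in S') (-1) ^+ h x * (h x)%:R ^+ i = 0 :> int)%R.
  apply: IH => [m ltm|m x ltm|m l x ltm ltl|m x ltm].
  - exact/fK/ltnW.
  - by rewrite !inE fS ?bf // 1?ltnW // gtn_eqF // addbF.
  - by apply: bf; apply: ltnW.
  - exact/hf/ltnW.
have S'E x : (x \in S) && ~~ b K x = (x \in S') by rewrite inE.
rewrite (bigID (b K)) /= (reindex_inj (inv_inj (fK K (leqnn _)))) /=.
under eq_bigl => x do rewrite fS // bf // eqxx addbT S'E.
under [X in (_ + X)%R]eq_bigl => x do rewrite S'E.
have hS x : x \in S' -> h (f K x) = (h x).+1.
  by rewrite -S'E => /andP[_ /negPf bx]; have := hf K x (leqnn _);
    rewrite bx addn0 addn1.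
under eq_bigr => x xS do
  (* The top term h^k of (h+1)^k is split off: it cancels against the unpaired half. *)
  rewrite hS // exprS -natr1 addrC exprDn big_ord_recr /= subnn expr0 mul1r binn mulr1n.
rewrite -big_split /=.
under eq_bigr => x xS.
  rewrite mulN1r mulNr mulrDr opprD addrNK mulr_sumr.
  over.
rewrite sumrN exchange_big big1 ?oppr0 //= => i _.
under eq_bigr => x xS do rewrite expr1n mul1r mulrnAr.
by rewrite sumrMnl IH' ?mul0rn // (leq_trans (ltn_ord i)).
Qed.

Lemma card_setb (T : finType) (P : pred T) : #|[set x | P x]| = \sum_x P x.
Proof.
by rewrite -sum1dep_card big_mkcond; apply: eq_bigr => x _; case: (P x).
Qed.

Lemma eq_odd_sum (I : finType) (F G : I -> nat) :
  (forall i, odd (F i) = odd (G i)) -> odd (\sum_i F i) = odd (\sum_i G i).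
Proof.
by move=> eqFG; rewrite !(big_morph odd oddD (erefl _)); apply: eq_bigr => i _.
Qed.

Section SuffixNegation.

Variable n : nat.
Implicit Types p : signed_perm n.

(** Window indices start at 0, so the entries at positions greater than [a] are negated: a suffix of
    length n - a. *)
Definition neg_suffix (a : nat) p : signed_perm n :=
  (p.1, [ffun i : 'I_n => p.2 i (+) (a <= i)]).

Lemma neg_suffixK a : involutive (neg_suffix a).
Proof.
move=> [s e]; congr pair; apply/ffunP => i.
by rewrite !ffunE /= -addbA addbb addbF.
Qed.

Lemma window_neg_suffix a p i :
  window (neg_suffix a p) i = ((-1) ^+ (a <= i) * window p i)%R.
Proof. by rewrite /window ffunE signr_addb; ring. Qed.

Lemma entry_neg_suffix a p m :
  entry (neg_suffix a p) m = ((-1) ^+ (a < m) * entry p m)%R.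
Proof.
case: m => [|m] /=; first by rewrite mulr0.
by case: insubP => [i _ <-|_]; rewrite ?mulr0 // window_neg_suffix.
Qed.

Lemma absz_window p i : `|window p i|%N = (p.1 i).+1.
Proof. by rewrite /window abszMsign. Qed.

Lemma absz_entry_neq p j : j < n -> `|entry p j|%N != `|entry p j.+1|%N.
Proof.
move=> ltj; rewrite /= insubT absz_window.
case: j ltj => [|j] ltj //=; rewrite insubT; first exact: ltnW.
move=> ltj'; rewrite absz_window eqSS -[_ == _]/(p.1 _ == p.1 _).
by rewrite (inj_eq perm_inj) -val_eqE /= neq_ltn ltnSn.
Qed.

Definition desc p j : bool := (entry p j.+1 < entry p j)%R.

Definition turn p j : bool := desc p j.-1 (+) desc p j.

Definition rise p a : bool := `|entry p a|%N < `|entry p a.+1|%N.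

Lemma rise_neg_suffix a b p : rise (neg_suffix a p) b = rise p b.
Proof. by rewrite /rise !entry_neg_suffix !abszMsign. Qed.

(** After position [a] both ends of a step are negated. At [a] only the right end is, and the order
    flips exactly when that end is larger in absolute value. *)
Lemma desc_neg_suffix a p j : j < n ->
  desc (neg_suffix a p) j = desc p j (+) ((a < j) || (j == a) && rise p a).
Proof.
move=> /(absz_entry_neq p); rewrite /desc !entry_neg_suffix /rise.
case: (ltngtP a j) => [ltaj|ltja|->] /=.
- by rewrite ltnS (ltnW ltaj) expr1; lia.
- by rewrite ltnS leqNgt ltja !expr0 !mul1r addbF.
- by rewrite ltnSn expr1 expr0; lia.
Qed.

Definition toggled p a : nat := if rise p a then a else a.+1.

(** The flipped steps are those from [toggled p a] on. A turn compares two consecutive steps, so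
    only the one at this boundary changes. *)
Lemma turn_neg_suffix a p j : 0 < a -> 0 < j < n ->
  turn (neg_suffix a p) j = turn p j (+) (j == toggled p a).
Proof.
move=> a_gt0 /andP[j_gt0 ltjn]; rewrite /turn !desc_neg_suffix //; last by lia.
by rewrite /toggled; case: (rise p a); lia.
Qed.

(** Adjacent entries are never equal, so peaks and valleys together are the changes between ascent
    and descent. *)
Lemma altruns_BE p : altruns_B p = (\sum_(i < n | 0 < i) turn p i).+1.
Proof.
rewrite /altruns_B addn1 /pk_B /val_B !card_setb -big_split; congr _.+1.
rewrite [RHS]big_mkcond; apply: eq_bigr => i _.
case: (posnP i) => [-> //|i_gt0].
move: (absz_entry_neq p (ltn_ord i)).
move: (absz_entry_neq p (leq_ltn_trans (leq_pred i) (ltn_ord i))).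
rewrite /turn /desc prednK //.
by move: (entry p _) (entry p _) (entry p _) => x y z /=; lia.
Qed.

Lemma altruns_neg_suffix a p : 0 < a -> a.+1 < n ->
  altruns_B (neg_suffix a p) + turn p (toggled p a) =
  altruns_B p + ~~ turn p (toggled p a).
Proof.
move=> a_gt0 lt_an; have lt_cn : toggled p a < n.
  by rewrite /toggled; case: ifP => // _; apply: ltnW.
have c_gt0 : 0 < toggled p a by rewrite /toggled; case: ifP.
pose c := Ordinal lt_cn.
have altrunsD1 q :
    altruns_B q = (turn q c + \sum_(i < n | (0 < i) && (i != c)) turn q i).+1.
  by rewrite altruns_BE (bigD1 c).
rewrite !altrunsD1 turn_neg_suffix ?c_gt0 //= eqxx.
under eq_bigr => i /andP[i_gt0 ne_ic].
  rewrite turn_neg_suffix ?i_gt0 ?ltn_ord // -[_ == _]/(i == c).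
  rewrite (negPf ne_ic) addbF; over.
by case: (turn p _) => /=; lia.
Qed.

(** For entries x before y, the indicators of x > y and -x > y add up to 1 if |x| > |y| and to 0 or
    2 otherwise, so their parity ignores signs. The count of negative entries changes parity n - a
    times. *)
Lemma odd_inv_B_neg_suffix a p : a <= n -> ~~ odd (n - a) ->
  odd (inv_B (neg_suffix a p)) = odd (inv_B p).
Proof.
move=> le_an even_an; rewrite /inv_B !card_setb -!big_split /= !oddD; congr addb.
  apply: eq_odd_sum => -[i j] /=; rewrite !window_neg_suffix.
  case: ltnP => //= lt_ij; have : `|window p i|%N != `|window p j|%N.
    rewrite !absz_window eqSS -[_ == _]/(p.1 i == p.1 j) (inj_eq perm_inj).
    by rewrite neq_ltn lt_ij.
  by case: (a <= i); case: (a <= j); rewrite ?expr1 ?expr0; lia.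
have suffix_size : \sum_(i < n) (a <= i) = n - a.
  rewrite -[RHS]muln1 -sum_nat_const_nat (big_nat_widenl _ 0) // big_mkord.
  by rewrite [RHS]big_mkcond; apply: eq_bigr => i _ /=; case: (a <= i).
rewrite -[RHS]addbF -(negPf even_an) -suffix_size -oddD -big_split /=.
apply: eq_odd_sum => i; rewrite window_neg_suffix.
have := absz_window p i.
by case: (a <= i); rewrite ?expr1 ?expr0; lia.
Qed.

End SuffixNegation.

Lemma sum_R_B (n k : nat) (eps : bool) (P : pred nat) : 0 < n ->
  \sum_(1 <= j < n.+1 | P j) j ^ k * R_B eps n j =
  \sum_(p in B_sign eps n | P (altruns_B p)) altruns_B p ^ k.
Proof.
move=> n_gt0.
pose g (p : signed_perm n) : 'I_n.+1 := inord (altruns_B p).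
have gE p : g p = altruns_B p :> nat by rewrite inordK // ltnS altruns_B_le.
rewrite (partition_big g (fun j : 'I_n.+1 => (0 < j) && P j)) /=; last first.
  by move=> p /andP[_ Pp]; rewrite gE Pp /altruns_B addn1.
rewrite (big_nat_widenl _ 0) // big_mkord; apply: eq_big => [j|j /andP[Pj _]].
  by rewrite andbC.
rewrite /R_B -sum1dep_card big_distrr /=; apply: congr_big => // [p|p].
  rewrite -[_ == j]/(g p == j :> nat) gE -andbA; congr andb.
  by case: eqP => [->|_]; rewrite ?Pj ?andbF.
by case/andP=> _ /eqP ->; rewrite muln1.
Qed.

Theorem theorem42 (n k : nat) (n_gt0 : 0 < n) (k_gt0 : 0 < k)
    (le_n : 2 * k + 3 <= n) (eps : bool) :
  \sum_(1 <= j < n.+1 | odd j) j ^ k * R_B eps n j =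
  \sum_(1 <= j < n.+1 | ~~ odd j) j ^ k * R_B eps n j.
Proof.
rewrite !sum_R_B //.
(* The suffix has even length 2m + 2. For m <= k the bound on [n] gives a m >= 1, and the spacing by
   2 keeps the candidate positions a m and a m + 1 disjoint for distinct m. *)
pose a m := n - 2 - m.*2.
pose b m (p : signed_perm n) := turn p (toggled p (a m)).
have Z : (\sum_(p in B_sign eps n)
    (-1) ^+ altruns_B p * (altruns_B p)%:R ^+ k = 0 :> int)%R.
  apply: (sum_sign_exp_eq0 (f := fun m => neg_suffix (a m)) (b := b)
            (K := k.+1)) => //.
  - by move=> m _; apply: neg_suffixK.
  - move=> m p lt_mk; rewrite /B_sign /B_minus; case: ifP => _; rewrite !inE;
      by rewrite odd_inv_B_neg_suffix // /a; lia.
  - move=> m l p lt_mk lt_lk; rewrite /b.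
    have -> : toggled (neg_suffix (a m) p) (a l) = toggled p (a l).
      by rewrite /toggled rise_neg_suffix.
    rewrite turn_neg_suffix; last 2 first.
    + by rewrite /a; lia.
    + by rewrite /toggled /a; case: ifP => _; lia.
    congr addb; case: (eqVneq l m) => [-> |ne_lm]; first by rewrite eqxx.
    by apply/negbTE; rewrite /toggled /a; do 2 case: ifP => _; lia.
  - by move=> m p lt_mk; apply: altruns_neg_suffix; rewrite /a; lia.
(* Over [int], the even sum minus the odd sum is the alternating sum [Z] split by parity. *)
apply/eqP; rewrite -(eqr_nat int) !natr_sum eq_sym -subr_eq0 -sumrN -[X in _ == X]Z.
rewrite [X in _ == X](bigID (fun p => odd (altruns_B p))) /= addrC; apply/eqP.
by congr (_ + _)%R; apply: eq_bigr => p /andP[_ odd_p]; rewrite natrX -signr_odd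
  ?odd_p ?(negPf odd_p) ?mulN1r ?mul1r.
Qed.
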